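(* Let $K/k$ be a separable field extension of degree $6$ and $\widetilde{K}/k$ its Galois closure. If $\operatorname{Gal}(\widetilde{K}/k)$ is isomorphic to the dihedral group $D_{2\cdot 6}$ of order $12$, or to $F_{18}$, or to $F_{18}:2$, then $K/k$ is almost classically Galois.
   Context: Here $F_{18}\simeq S_3\times C_3$ (the transitive group $6T5$ of degree $6$ and order $18$) and $F_{18}:2\simeq S_3\times S_3$ (the transitive group $6T9$ of degree $6$ and order $36$). Let $L/k$ be a finite separable extension with Galois closure $\widetilde{L}/k$, $\Gamma=\operatorname{Gal}(\widetilde{L}/k)$, $\Gamma'=\operatorname{Gal}(\widetilde{L}/L)$, and let $\lambda:\Gamma\to\operatorname{Sym}(\Gamma/\Gamma')$ be the left translation action on left cosets. $L/k$ is called almost classically Galois if there is a regular (i.e. sharply transitive) subgroup $N$ of $\operatorname{Sym}(\Gamma/\Gamma')$ which is normalized by $\lambda(\Gamma)$ and contained in $\lambda(\Gamma)$; equivalently, $\Gamma'$ has a normal complement in $\Gamma$. *)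

(* Defs.v *)
From HB Require Import structures.
From mathcomp Require Export all_boot all_order all_fingroup all_algebra all_solvable all_field.

Set Implicit Arguments.
Unset Strict Implicit.
Unset Printing Implicit Defensive.

Local Open Scope group_scope.

Section CosetAction.

Variables (gT : finGroupType) (G H : {group gT}).

(* Sym(G/H) is represented by the permutations of {set gT} with support in
   [lcosets H G], the set of the left cosets of H in G. *)

Definition lcoset_perm (x : gT) : {perm {set gT}} := perm (@lcoset_inj gT x).

Definition left_translation (x : gT) : {perm {set gT}} :=
  restr_perm (lcosets H G) (lcoset_perm x).

Lemma left_translationE x A :
  x \in G -> A \in lcosets H G -> left_translation x A = x *: A.
Proof.
move=> Gx GHA; rewrite restr_permE ?permE //; apply/astabsP => B.
rewrite /= apermE permE; apply/lcosetsP/lcosetsP => [[y Gy eqB] | [y Gy ->]].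
  by exists (x^-1 * y); rewrite ?groupM ?groupV // lcosetM -eqB lcosetK.
by exists (x * y); rewrite ?groupM // lcosetM.
Qed.

(* mathcomp composes permutations from left to right, so [left_translation]
   reverses products; only its image matters below. *)
Definition left_translations : {set {perm {set gT}}} :=
  [set left_translation x | x in G].

End CosetAction.

Definition sharply_transitive (T : finType) (S : {set T})
    (N : {set {perm T}}) : Prop :=
  {in S &, forall x y, exists! s : {perm T}, s \in N /\ s x = y}.

(* N is a regular subgroup of Sym S. *)
Definition regular_on (T : finType) (S : {set T}) (N : {group {perm T}}) : Prop :=
  {in N, forall s, perm_on S s} /\ sharply_transitive S N.

Section Extensions.

Variables (F : fieldType) (L : splittingFieldType F).
Implicit Types k K M : {subfield L}.

(* M/k is the Galois closure of K/k: the smallest Galois extension of k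
   containing K. *)
Definition is_galois_closure k K M : Prop :=
  [/\ (K <= M)%VS, galois k M &
      forall E : {subfield L}, (K <= E)%VS -> galois k E -> (M <= E)%VS].

(* K/k is almost classically Galois, where M is the Galois closure of K/k.
   In mathcomp the product x * y of 'Gal(M / k) is "x followed by y", so this
   group is the opposite of the usual one; since a group is isomorphic to its
   opposite by inversion, which preserves subgroups, this does not affect
   the definition. *)
Definition almost_classically_galois k K M : Prop :=
  exists N : {group {perm {set gal_of M}}},
    [/\ regular_on (lcosets 'Gal(M / K) 'Gal(M / k)) N,
        left_translations 'Gal(M / k) 'Gal(M / K) \subset 'N(N) &
        N \subset left_translations 'Gal(M / k) 'Gal(M / K)].

End Extensions.

(* Main.v *)
Require Import Defs.

Set Implicit Arguments.
Unset Strict Implicit.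
Unset Printing Implicit Defensive.

Local Open Scope group_scope.

(* With G = Gal(M/k) and H = Gal(M/K), a normal complement of H acts regularly
   on the cosets of H by left translation. The fixed field of the core of H is
   Galois over k and contains K, so H is core-free by minimality of M. If
   G = D_12, the rotation subgroup is the complement; if G = S_3 x B, with
   B = C_3 or S_3, the factor S_3 is. *)

(** * Left translations and regular subgroups *)

Lemma left_translationM (gT : finGroupType) (G H : {group gT}) x y :
  x \in G -> y \in G ->
  left_translation G H (x * y) =
    left_translation G H y * left_translation G H x.
Proof.
move=> Gx Gy; apply/permP=> A; rewrite permM.
have [GHA | GH'A] := boolP (A \in lcosets H G); last first.
  by rewrite !(out_perm (restr_perm_on _ _) GH'A).
rewrite !left_translationE ?groupM // -?lcosetM //.
case/lcosetsP: GHA => z Gz ->; apply/lcosetsP.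
by exists (y * z); rewrite ?groupM ?lcosetM.
Qed.

Lemma left_translation1 (gT : finGroupType) (G H : {group gT}) :
  left_translation G H 1 = 1.
Proof.
by apply: (mulgI (left_translation G H 1)); rewrite -left_translationM ?mulg1.
Qed.

Lemma left_translationV (gT : finGroupType) (G H : {group gT}) x :
  x \in G -> left_translation G H x^-1 = (left_translation G H x)^-1.
Proof.
move=> Gx; apply: (mulgI (left_translation G H x)).
by rewrite mulgV -left_translationM ?groupV // mulVg left_translation1.
Qed.

(** Since [left_translation] reverses products, it is not a morphism, and closure of the image is
    checked by hand. *)
Lemma left_translations_group_set (gT : finGroupType) (G H N : {group gT}) :
  N \subset G -> group_set (left_translation G H @: N).
Proof.
move=> sNG; apply/group_setP; split.
  by apply/imsetP; exists 1; rewrite ?left_translation1.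
move=> _ _ /imsetP[x Nx ->] /imsetP[y Ny ->].
by rewrite -left_translationM ?(subsetP sNG) ?imset_f ?groupM.
Qed.

(** The witness is the image of [N]: [N * H = G] makes it transitive on the cosets, [N :&: H = 1]
    makes it sharply so, and normality of [N] makes it normalized by all translations. *)
Lemma regular_of_normal_complement (gT : finGroupType) (G H N : {group gT}) :
  N <| G -> N :&: H = 1 -> N * H = G ->
  exists R : {group {perm {set gT}}},
    [/\ regular_on (lcosets H G) R,
        left_translations G H \subset 'N(R) &
        R \subset left_translations G H].
Proof.
move=> nsNG tiNH defG; have [sNG nNG] := andP nsNG.
have GN := subsetP sNG.
have cosetN A : A \in lcosets H G -> exists2 n, n \in N & A = n *: H.
  case/lcosetsP=> g; rewrite -defG => /mulsgP[n h Nn Hh ->] ->.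
  by exists n; rewrite // lcosetM lcoset_id.
have cosetE n : n \in N -> n *: H \in lcosets H G.
  by move=> Nn; apply/lcosetsP; exists n; rewrite ?GN.
exists (Group (left_translations_group_set H sNG)); split=> /=; first split.
- by move=> _ /imsetP[n Nn ->]; apply: restr_perm_on.
- move=> _ _ /cosetN[a Na ->] /cosetN[b Nb ->].
  exists (left_translation G H (b * a^-1)); split.
    split; first by rewrite imset_f ?groupM ?groupV.
    by rewrite left_translationE ?GN ?cosetE ?groupM ?groupV // -lcosetM mulgKV.
  move=> _ [/imsetP[n Nn ->]].
  rewrite left_translationE ?GN ?cosetE // -lcosetM => eq_nab.
  have: b^-1 * (n * a) \in N :&: H.
    rewrite inE -[X in _ && X]mem_lcoset -eq_nab lcoset_refl andbT.
    by rewrite !groupM ?groupV.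
  by rewrite tiNH => /set1P/eqP; rewrite -eq_mulVg1 => /eqP ->; rewrite mulgK.
- apply/subsetP=> _ /imsetP[x Gx ->]; rewrite inE.
  apply/subsetP=> _ /imsetP[_ /imsetP[n Nn ->] ->].
  (* As products are reversed, conjugating by the translation by [x] gives the translation by
     [n ^ x^-1]. *)
  rewrite /conjg -left_translationV // -!left_translationM ?groupM ?groupV ?(GN n) //.
  rewrite imset_f // -mulgA -{1}(invgK x) -/(conjg n x^-1).
  by rewrite memJ_norm ?groupV ?(subsetP nNG).
- exact: imsetS.
Qed.

(** * Core-free subgroups of a direct product *)

Lemma gcore1_normal_eq1 (gT : finGroupType) (G H X : {group gT}) :
  gcore H G = 1 -> X <| G -> X \subset H -> X = 1 :> {set gT}.
Proof.
move=> coreH /andP[_ nXG] sXH.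
by apply/trivgP; rewrite -coreH gcore_max.
Qed.

(** A Sylow 3-subgroup has order 3 and index 1 or 2, so it is normal. *)
Lemma card_pcore3 (gT : finGroupType) (X : {group gT}) :
  (#|X| = 3 \/ #|X| = 6) -> 3.-Sylow(X) 'O_3(X) /\ #|'O_3(X)| = 3.
Proof.
move=> oX; have [P sylP] := Sylow_exists 3 X.
have oP: #|P| = 3 by rewrite (card_Hall sylP) p_part; case: oX => ->.
have nsPX: P <| X.
  have sPX := pHall_sub sylP; case: oX => oX.
    suff ->: X :=: P by apply: normal_refl.
    by apply/eqP; rewrite eq_sym eqEcard sPX oX oP.
  by apply: index2_normal; rewrite -?divgS // oX oP.
by rewrite (normal_Hall_pcore sylP nsPX).
Qed.

(* The Sylow 3-subgroups P, Q, R of H, A, B are normal in H, G, G. As H is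
   core-free, P differs from R, so PR = QR. The subgroup A :&: H has no element
   of order 3, since otherwise P = Q; hence it commutes with P, and with R
   because it lies in A. It therefore centralises Q, and were it nontrivial,
   A = (A :&: H)Q would be abelian. *)
Lemma dprod_TI_core_free (gT : finGroupType) (A B G H : {group gT}) :
  A \x B = G -> #|A| = 6 -> ~~ abelian A -> (#|B| = 3 \/ #|B| = 6) ->
  H \subset G -> #|H| = #|B| -> gcore H G = 1 -> A :&: H = 1.
Proof.
move=> defG oA not_cAA oB sHG oH coreH.
have [nsAG nsBG] := dprod_normal2 defG.
have [_ defAB cAB tiAB] := dprodP defG.
have [|sylP oP] := card_pcore3 (X := H); first by rewrite oH.
have [|sylQ oQ] := card_pcore3 (X := A); first by right.
have [sylR oR] := card_pcore3 oB.
set P := 'O_3(H)%G in sylP oP; set Q := 'O_3(A)%G in sylQ oQ.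
set R := 'O_3(B)%G in sylR oR.
have nsQG: Q <| G := char_normal_trans (pcore_char 3 A) nsAG.
have nsRG: R <| G := char_normal_trans (pcore_char 3 B) nsBG.
have nsPH: P <| H := pcore_normal 3 H.
have sPH := normal_sub nsPH.
have sQA: Q \subset A := pcore_sub 3 A.
have sRB: R \subset B := pcore_sub 3 B.
have pr_P: prime #|P| by rewrite oP.
have notPX (X : {group gT}) : X <| G -> #|X| = 3 -> ~~ (P \subset X).
  move=> nsXG oX; apply/negP=> sPX.
  have eqPX: P :=: X by apply/eqP; rewrite eqEcard sPX oX oP.
  have := oX; rewrite (gcore1_normal_eq1 coreH nsXG) ?cards1 //.
  by rewrite -eqPX.
have tiQR: Q :&: R = 1 by apply/trivgP; rewrite -tiAB setISS.
have tiPR: P :&: R = 1 by rewrite prime_TIg ?notPX.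
have nsQRG: Q <*> R <| G := normalY nsQG nsRG.
have cQR: Q \subset 'C(R) by rewrite (subset_trans sQA) ?(centsS sRB) // centsC.
have pQ := pHall_pgroup sylQ; have pR := pHall_pgroup sylR.
(* The order of [G] is 18 or 36, with 3-part 9. Being normal, this Sylow subgroup contains [P]. *)
have sylQR: 3.-Sylow(G) (Q * R).
  rewrite -cent_joinEl // pHallE normal_sub //= cent_joinEl // TI_cardMg //.
  rewrite -(dprod_card defG) oA oQ oR p_part.
  by case: oB => ->.
have sPQR: P \subset Q * R.
  rewrite -cent_joinEl // in sylQR *.
  rewrite (sub_normal_Hall sylQR) ?(subset_trans sPH) //.
  exact: pHall_pgroup sylP.
have defQR: Q * R = P * R.
  apply/eqP; rewrite eq_sym eqEcard !TI_cardMg // oP oQ leqnn andbT.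
  by rewrite (subset_trans (mulSg R sPQR)) // -mulgA mulGid.
have nsDH: A :&: H <| H by rewrite setIC (normalGI sHG nsAG).
have sDA: A :&: H \subset A := subsetIl A H.
have tiDP: A :&: H :&: P = 1.
  rewrite [LHS]setIC (prime_TIg pr_P) //; apply/negP=> /subsetIP[sPA _].
  case/negP: (notPX Q nsQG oQ).
  by rewrite (sub_normal_Hall sylQ) ?pcore_normal // (pHall_pgroup sylP).
(* Both groups are normal in [H], so their commutator lies in their trivial intersection. *)
have cDP: A :&: H \subset 'C(P).
  apply/commG1P/trivgP; rewrite -tiDP commg_subI //.
    by rewrite subsetI subxx (subset_trans (normal_sub nsDH)) ?normal_norm.
  by rewrite subsetI subxx (subset_trans sPH) ?normal_norm.
have cDQ: A :&: H \subset 'C(Q).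
  have cDR: A :&: H \subset 'C(R).
    by rewrite (subset_trans sDA) // centsC (subset_trans sRB).
  have: A :&: H \subset 'C(Q * R) by rewrite defQR centM subsetI cDP.
  by rewrite centM subsetI => /andP[].
(* This is a 3-subgroup of [H], hence lies in [P], which meets [A :&: H] trivially. *)
have tiDQ: A :&: H :&: Q = 1.
  apply/trivgP; rewrite -tiDP subsetI subsetIl /=.
  rewrite (sub_normal_Hall sylP) ?(pgroupS (subsetIr _ _) pQ) //.
  exact: subset_trans (subsetIl _ _) (subsetIr _ _).
apply/eqP; apply/idPn => ntD; case/negP: not_cAA.
(* The order of [(A :&: H) * Q] is three times that of [A :&: H] and is at most 6. *)
have oD: #|A :&: H| = 2.
  have: #|(A :&: H) * Q| %| #|A|.
    by rewrite -cent_joinEl // cardSg // join_subG sDA.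
  rewrite TI_cardMg // oQ => /dvdn_leq; rewrite oA => /(_ isT).
  rewrite -[6]/(2 * 3)%N leq_pmul2r // => leD2.
  by apply/eqP; rewrite eqn_leq leD2 cardG_gt1.
have <-: (A :&: H) * Q = A.
  apply/eqP; rewrite eqEcard TI_cardMg // oD oQ oA andbT.
  by rewrite -cent_joinEl // join_subG sDA.
rewrite abelianM cyclic_abelian ?prime_cyclic ?oD //=.
by rewrite cyclic_abelian ?prime_cyclic ?oQ // centsC.
Qed.

(** * Normal complements in the three groups *)

Lemma Sym3_nonabelian : ~~ abelian [set: 'S_3].
Proof.
pose i := @Ordinal 3; apply/negP=> /centsP cS3.
have := cS3 (tperm (i 0%N isT) (i 1%N isT)) (in_setT _)
            (tperm (i 1%N isT) (i 2%N isT)) (in_setT _).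
(* The two products send 0 to 2 and to 1 respectively. *)
move/permP/(_ (i 0%N isT)); rewrite !permM tpermL (tpermD (z := i 0 isT)) //.
by rewrite !tpermL.
Qed.

(** Otherwise [H], of prime order, lies in [C]. Subgroups of a cyclic group are characteristic, so
    [H] would be normal in [G], hence trivial. *)
Lemma cyclic_normal_TI_core_free (gT : finGroupType) (G H C : {group gT}) :
  C <| G -> cyclic C -> prime #|H| -> gcore H G = 1 -> C :&: H = 1.
Proof.
move=> nsCG cycC pr_H coreH; rewrite setIC prime_TIg //.
apply/negP=> sHC; have := pr_H.
rewrite (gcore1_normal_eq1 coreH (X := H)) ?cards1 //.
by apply: char_normal_trans nsCG; rewrite sub_cyclic_char.
Qed.

Lemma D12_normal_complement (gT : finGroupType) (G H : {group gT}) :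
  G \isog [set: 'D_12] -> #|G : H| = 6 -> H \subset G -> gcore H G = 1 ->
  exists N : {group gT}, [/\ N <| G, #|N| = 6 & N :&: H = 1].
Proof.
move=> isoG iHG sHG coreH.
have oG: #|G| = 12 by rewrite (card_isog isoG) (card_dihedral (q := 6)).
have oH: #|H| = 2 
  by apply/eqP; rewrite -(eqn_pmul2r (m := 6)) // -{1}iHG Lagrange ?oG.
have: G \homg [set: 'D_12] by apply: isog_hom.
rewrite (@Grp_dihedral 6) // => /existsP[[x y]] /=.
rewrite !xpair_eqE => /and4P[/eqP defG x6 y2 xy].
have nxy: <[y]> \subset 'N(<[x]>).
  by rewrite cycle_subG; apply/normP; rewrite -cycleJ (eqP xy) cycleV.
have nsxG: <[x]> <| G by rewrite -defG normalYl.
(* The relations only bound the orders of [x] and [y] by 6 and 2; that [G] has order 12 forces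
   equality. *)
have ox: #[x] = 6.
  have le_x6: #[x] <= 6 by rewrite dvdn_leq // order_dvdn.
  have le_y2: #[y] <= 2 by rewrite dvdn_leq // order_dvdn.
  apply/eqP; rewrite eqn_leq le_x6 -(leq_pmul2r (m := 2)) //=.
  rewrite (leq_trans _ (leq_mul (leqnn _) le_y2)) //.
  by rewrite -[(6 * 2)%N]oG -defG norm_joinEr // mul_cardG leq_pmulr ?cardG_gt0.
exists <[x]>%G; split=> //.
by rewrite (cyclic_normal_TI_core_free nsxG) ?cycle_cyclic ?oH.
Qed.

(** Only the order of the second factor matters, so [rT] stands for both C_3 and S_3. The complement
    is the image of the first factor. *)
Lemma S3_dprod_normal_complement (gT rT : finGroupType) (G H : {group gT}) :
  G \isog [set: 'S_3 * rT] -> (#|rT| = 3 \/ #|rT| = 6) ->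
  #|G : H| = 6 -> H \subset G -> gcore H G = 1 ->
  exists N : {group gT}, [/\ N <| G, #|N| = 6 & N :&: H = 1].
Proof.
rewrite isog_sym => /isogP[f injf defG] oT iHG sHG coreH.
have oS3: #|[set: 'S_3]| = 6 by rewrite cardsT card_Sn.
have := setX_dprod [set: 'S_3]%G [set: rT]%G.
rewrite (_ : setX [set: 'S_3]%G [set: rT]%G = [set: 'S_3 * rT]); last first.
  by apply/setP=> -[s t]; rewrite in_setX !inE.
move/(injm_dprod (subxx _) injf); rewrite defG => dprodG.
set A := f @* _ in dprodG; set B := f @* _ in dprodG.
have oA: #|A| = 6 by rewrite card_injm ?subsetT // cardsX cards1 oS3.
have oB: #|B| = #|rT| by rewrite card_injm ?subsetT // cardsX cards1 cardsT mul1n.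
have not_cAA: ~~ abelian A.
  rewrite injm_abelian ?subsetT //; apply: contra Sym3_nonabelian => /centsP cXX.
  apply/centsP=> s _ t _.
  by apply: (congr1 fst (cXX (s, 1) _ (t, 1) _)); rewrite in_setX !inE eqxx.
have oH: #|H| = #|B|.
  apply/eqP; rewrite -(eqn_pmul2r (m := 6)) // -{1}iHG Lagrange //.
  by rewrite -(dprod_card dprodG) oA mulnC.
exists [group of A]; rewrite (proj1 (dprod_normal2 dprodG)); split=> //.
by apply: (dprod_TI_core_free dprodG); rewrite // oB.
Qed.

(** * Galois closures *)

Lemma galois_closure_gcore1 (F : fieldType) (L : splittingFieldType F)
    (k K M : {subfield L}) :
  (k <= K)%VS -> is_galois_closure k K M ->
  gcore 'Gal(M / K) 'Gal(M / k) = 1.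
Proof.
move=> sKk [sKM galM minM].
have nsC: gcore 'Gal(M / K) 'Gal(M / k) <| 'Gal(M / k).
  by rewrite gcore_normal ?galS.
have galC := normal_fixedField_galois galM (G := (gcore_group _ _)%G) nsC.
have sMC: (M <= fixedField (gcore 'Gal(M / K) 'Gal(M / k)))%VS.
  by apply: (minM [aspace of fixedField _]); rewrite // -galois_connection ?gcore_sub.
(* An element of the core fixes [M] pointwise, hence is the identity of [gal_of M]. *)
apply/trivgP/subsetP=> x Cx; rewrite inE; apply/gal_eqP=> a Ma.
by rewrite gal_id; apply: (fixedFieldP Ma (subvP sMC a Ma)).
Qed.

Theorem proposition4p2 (F : fieldType) (L : splittingFieldType F)
    (k K M : {subfield L}) :
  (k <= K)%VS -> separable k K -> \dim_k K = 6 ->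
  is_galois_closure k K M ->
  [|| 'Gal(M / k)%g \isog [set: 'D_12]%g,
      'Gal(M / k)%g \isog [set: 'S_3 * 'Z_3]%g |
      'Gal(M / k)%g \isog [set: 'S_3 * 'S_3]%g] ->
  almost_classically_galois k K M.
Proof.
move=> skK _ dimK closM isoG.
have coreH := galois_closure_gcore1 skK closM.
have [sKM galM _] := closM.
have sHG: 'Gal(M / K) \subset 'Gal(M / k) by rewrite galS.
have galKM: galois K M by apply: galoisS galM; rewrite skK.
have iHG: #|'Gal(M / k) : 'Gal(M / K)| = 6.
  by rewrite -dim_fixed_galois // (galois_fixedField galKM).
suff [N [nsNG oN tiNH]]: exists N : {group gal_of M},
    [/\ N <| 'Gal(M / k), #|N| = 6 & N :&: 'Gal(M / K) = 1].
  apply: (regular_of_normal_complement nsNG tiNH).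
  (* The product [N * H] fills the group by counting: the order of [N] equals the index of [H]. *)
  apply/eqP; rewrite eqEcard mul_subG ?(normal_sub nsNG) // TI_cardMg //.
  by rewrite -(Lagrange sHG) iHG oN mulnC leqnn.
case/or3P: isoG => isoG.
- exact: D12_normal_complement isoG iHG sHG coreH.
- by apply: S3_dprod_normal_complement isoG _ iHG sHG coreH; left; rewrite card_ord.
- by apply: S3_dprod_normal_complement isoG _ iHG sHG coreH; right; rewrite card_Sn.
Qed.
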